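(* Let $I\colon (x,y)\mapsto (x,y)$ on $\mathbb{R}^2$, let $P^{(1)}\colon (x,y)\mapsto \left(\frac{y}{x},\frac{1}{x}\right)$ for all $(x,y)\in\mathbb{R}^2$ with $x\neq 0$, and let $P^{(2)}\colon (x,y)\mapsto\left(\frac{1}{y},\frac{x}{y}\right)$ for all $(x,y)\in\mathbb{R}^2$ with $y\ne 0$. Then $I$, $P^{(1)}$, $P^{(2)}$ form, under composition, a group of order three: $$I\circ I=I,\quad P^{(1)}\circ I=I\circ P^{(1)}=P^{(1)},\quad P^{(2)}\circ I=I\circ P^{(2)}=P^{(2)},$$ $$P^{(1)}\circ P^{(2)}=P^{(2)}\circ P^{(1)}=I,\quad P^{(1)}\circ P^{(1)}=P^{(2)},\quad P^{(2)}\circ P^{(2)}=P^{(1)}.$$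
   Context: The maps $P^{(1)}$ and $P^{(2)}$ are called the first and the second maps of Poincaré of the plane. They are partially defined rational maps; the composition identities are understood as identities of rational (birational) maps of the plane, i.e. as equalities at all points where the compositions on the left are defined. *)

(* Defs.v *)
From mathcomp Require Import all_boot all_order all_algebra all_fingroup.
From mathcomp Require Import classical_sets reals.

Set Implicit Arguments.
Unset Strict Implicit.
Unset Printing Implicit Defensive.

Import GRing.Theory Num.Theory.
Local Open Scope ring_scope.
Local Open Scope classical_set_scope.

(* Partially defined maps of the real plane; [None] means undefined. They are
   composed with [pcomp]: [pcomp f g] is f o g, defined at z exactly when g is
   defined at z and f is defined at g(z). *)
Definition planeMap (R : realType) : Type := R * R -> option (R * R).

Section PoincareMaps.
Variable R : realType.

Definition idMap : planeMap R := fun z => Some z.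

Definition poincare1 : planeMap R :=
  fun '(x, y) => if x != 0 then Some (y / x, 1 / x) else None.

Definition poincare2 : planeMap R :=
  fun '(x, y) => if y != 0 then Some (1 / y, x / y) else None.

(* The sense given to the individual identities f = g, where f is a
   composition: equality at all the points where f is defined. Since
   P1 o P2 (defined for y <> 0) and P2 o P1 (defined for x <> 0) have different
   domains, this relation is not symmetric. *)
Definition eq_where_defined (f g : planeMap R) : Prop :=
  forall z w : R * R, f z = Some w -> g z = Some w.

(* Equality of rational maps: both maps are defined and coincide on a nonempty
   Zariski-open set, which may be taken of the form p(x, y) <> 0. In
   [{poly {poly R}}] the inner variable is x and the outer variable is y. *)
Definition eq_rational (f g : planeMap R) : Prop :=
  exists2 p : {poly {poly R}}, p != 0 &
    forall x y : R, p.[y%:P].[x] != 0 ->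
      exists w : R * R, f (x, y) = Some w /\ g (x, y) = Some w.

(* The elements of S, taken up to equality of rational maps, form a group of
   order n under composition. The last two clauses say that the labels phi are
   faithful and that the group law is composition. *)
Definition group_of_order_under_composition (n : nat) (S : set (planeMap R))
    : Prop :=
  exists (gT : finGroupType) (phi : gT -> planeMap R),
    [/\ #|gT| = n,
        range phi = S,
        (forall a b : gT, eq_rational (phi a) (phi b) -> a = b) &
        (forall a b : gT,
           eq_rational (pcomp (phi a) (phi b)) (phi (a * b)%g))].

End PoincareMaps.

Arguments idMap {R}.
Arguments poincare1 {R}.
Arguments poincare2 {R}.

(* Main.v *)
Require Import Defs.
From mathcomp Require Import all_boot all_order all_algebra all_fingroup.
From mathcomp Require Import classical_sets reals.
From mathcomp Require Import ring.

(** Write [P] for [poincare1]. In the homogeneous coordinates (x : y : 1) of the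
    projective plane, [P] sends (x : y : 1) to (y : 1 : x): it is a cyclic
    permutation of the three coordinates, and [poincare2] is the inverse
    permutation. Hence the three maps compose like the integers modulo 3, and
    each identity is a computation with fractions ([pcomp_cyclicMap]).

    All three maps are defined on the torus x y <> 0, where no homogeneous
    coordinate vanishes, and preserve it ([cyclicMap_torus]); so an identity
    that holds wherever the composition is defined is an identity of rational
    maps, with p = x y as witness ([eq_rational_of_torus]).

    The three maps are pairwise distinct as rational maps: where two of them
    agree on the torus, the point is fixed by a nontrivial cyclic permutation of
    the coordinates, so x ^ 3 = 1. A nonzero polynomial p times
    x y (x ^ 3 - 1) is again nonzero, hence does not vanish at some point, because
    the field is infinite ([nonvanishing_point]); at that point p does not vanish
    and the two maps differ, so p cannot witness their equality. *)

Import GRing.Theory Num.Theory.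
Local Open Scope ring_scope.
Local Open Scope classical_set_scope.

(** * Polynomials that do not vanish identically *)

(** Stated over a domain so that it applies to the coefficient ring [{poly R}],
    with constants as values, as well as to [R] itself. *)
Lemma nonroot_in_injective_seq {D : idomainType} {f : nat -> D} {p : {poly D}} :
  injective f -> p != 0 -> exists n, p.[f n] != 0.
Proof.
move=> f_inj p_neq0.
have [n_root|] := boolP (all (root p) (mkseq f (size p))); last first.
  by case/allPn=> _ /mapP[n _ ->] pn; exists n.
have := max_poly_roots p_neq0 n_root (mkseq_uniq _ f_inj).
by rewrite size_mkseq ltnn.
Qed.

Lemma nonvanishing_point {R : numDomainType} {p : {poly {poly R}}} :
  p != 0 -> exists x y : R, p.[y%:P].[x] != 0.
Proof.
move=> p_neq0.
have natr_inj : injective (fun n : nat => n%:R : R) by exact: mulrIn (oner_neq0 R).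
have [m pm] := nonroot_in_injective_seq (inj_comp (@polyC_inj R) natr_inj) p_neq0.
have [n pmn] := nonroot_in_injective_seq natr_inj pm.
by exists n%:R, m%:R.
Qed.

(** * The three maps as powers of one cyclic map *)

Section CyclicMaps.
Variable R : realType.

Definition cyclicMap (a : 'I_3) : planeMap R :=
  match val a with 0%N => idMap | 1%N => poincare1 | _ => poincare2 end.

Lemma range_cyclicMap :
  range cyclicMap = [set idMap; poincare1; poincare2 : planeMap R].
Proof.
rewrite eqEsubset; split=> [_ [[[|[|[|//]]] ?] _ <-]|f [[->|->]|->]] /=.
- by left; left.
- by left; right.
- by right.
- by exists (inord 0) => //; rewrite /cyclicMap /= inordK.
- by exists (inord 1) => //; rewrite /cyclicMap /= inordK.
- by exists (inord 2) => //; rewrite /cyclicMap /= inordK.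
Qed.

Lemma pcomp_idMapl (f : planeMap R) : eq_where_defined (pcomp idMap f) f.
Proof. by move=> z w; rewrite /pcomp; case: (f z). Qed.

Lemma pcomp_idMapr (f : planeMap R) : eq_where_defined (pcomp f idMap) f.
Proof. by []. Qed.

Lemma poincare12 :
  eq_where_defined (pcomp poincare1 poincare2) (idMap : planeMap R).
Proof.
move=> [x y] w; rewrite /pcomp /=; case: ifPn => //= y0; case: ifPn => //= _.
by move=> <-; congr (Some (_, _)); field.
Qed.

Lemma poincare21 :
  eq_where_defined (pcomp poincare2 poincare1) (idMap : planeMap R).
Proof.
move=> [x y] w; rewrite /pcomp /=; case: ifPn => //= x0; case: ifPn => //= _.
by move=> <-; congr (Some (_, _)); field.
Qed.

Lemma poincare11 :
  eq_where_defined (pcomp poincare1 poincare1) (poincare2 : planeMap R).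
Proof.
move=> [x y] w; rewrite /pcomp /=; case: ifPn => //= x0; case: ifPn => //=.
rewrite mulf_eq0 invr_eq0 (negbTE x0) orbF => y0; rewrite y0.
by move=> <-; congr (Some (_, _)); field; rewrite ?x0 ?y0.
Qed.

Lemma poincare22 :
  eq_where_defined (pcomp poincare2 poincare2) (poincare1 : planeMap R).
Proof.
move=> [x y] w; rewrite /pcomp /=; case: ifPn => //= y0; case: ifPn => //=.
rewrite mulf_eq0 invr_eq0 (negbTE y0) orbF => x0; rewrite x0.
by move=> <-; congr (Some (_, _)); field; rewrite ?x0 ?y0.
Qed.

(** The group law [a * b] of ['I_3] is addition modulo 3, so the nine cases are
    the entries of the composition table. *)
Lemma pcomp_cyclicMap (a b : 'I_3) :
  eq_where_defined (pcomp (cyclicMap a) (cyclicMap b)) (cyclicMap (a * b)%g).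
Proof.
case: a b => [[|[|[|//]]] ?] [[|[|[|//]]] ?]; rewrite /cyclicMap /=.
- exact: pcomp_idMapl.
- exact: pcomp_idMapl.
- exact: pcomp_idMapl.
- exact: pcomp_idMapr.
- exact: poincare11.
- exact: poincare12.
- exact: pcomp_idMapr.
- exact: poincare21.
- exact: poincare22.
Qed.

(** * Equality of rational maps on the torus *)

Lemma cyclicMap_torus (a : 'I_3) {x y : R} : x != 0 -> y != 0 ->
  exists u v : R, [/\ cyclicMap a (x, y) = Some (u, v), u != 0 & v != 0].
Proof.
move=> x0 y0; case: a => [[|[|[|//]]] ?]; rewrite /cyclicMap /= ?x0 ?y0.
- by exists x, y.
- by exists (y / x), (1 / x); rewrite !mulf_neq0 ?invr_eq0 ?oner_neq0.
- by exists (1 / y), (x / y); rewrite !mulf_neq0 ?invr_eq0 ?oner_neq0.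
Qed.

Lemma eq_rational_of_torus {f g : planeMap R} :
    (forall x y : R, x != 0 -> y != 0 -> exists w, f (x, y) = Some w) ->
  eq_where_defined f g -> eq_rational f g.
Proof.
move=> f_def fg; exists ('X%:P * 'X) => [|x y].
  by rewrite mulf_neq0 ?polyC_eq0 ?polyX_eq0.
rewrite !hornerE mulf_eq0 negb_or => /andP[x0 y0].
by have [w fw] := f_def x y x0 y0; exists w; rewrite (fg _ _ fw).
Qed.

Lemma eq_rational_pcomp_cyclicMap (a b : 'I_3) :
  eq_rational (pcomp (cyclicMap a) (cyclicMap b)) (cyclicMap (a * b)%g).
Proof.
apply: eq_rational_of_torus (pcomp_cyclicMap a b) => x y x0 y0.
have [u [v [buv u0 v0]]] := cyclicMap_torus b x0 y0.
have [s [t [ast _ _]]] := cyclicMap_torus a u0 v0.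
by exists (s, t); rewrite /pcomp buv.
Qed.

(** Multiplying the witness of equality by x y (x ^ 3 - 1) gives a point of
    agreement that avoids the three curves x = 0, y = 0 and x ^ 3 = 1. *)
Lemma eq_rational_agree {f g : planeMap R} : eq_rational f g ->
  exists x y : R, [/\ x != 0, y != 0, x ^+ 3 != 1 &
    exists w, f (x, y) = Some w /\ g (x, y) = Some w].
Proof.
move=> [p p0 fg].
have q0 : p * ('X * ('X * ('X^3 - 1))%:P) != 0.
  rewrite !mulf_neq0 ?polyC_eq0 ?polyX_eq0 //.
  by rewrite mulf_neq0 ?polyX_eq0 // monic_neq0 ?monic_Xn_sub_1.
have [x [y]] := nonvanishing_point q0.
rewrite !hornerE !mulf_eq0 subr_eq0 !negb_or => /andP[/andP[/andP[pxy y0] x0] x3].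
by exists x, y; split=> //; apply: fg.
Qed.

(** If a nontrivial cyclic permutation of the coordinates fixes (x : y : 1), it
    scales the vector (x, y, 1) by a cube root of unity, which forces x ^ 3 = 1.
    The goal is symmetric in the two maps, which leaves three pairs. *)
Lemma cyclicMap_agree {a b : 'I_3} {x y : R} :
    x != 0 -> y != 0 -> x ^+ 3 != 1 ->
  cyclicMap a (x, y) = cyclicMap b (x, y) -> a = b.
Proof.
move=> x0 y0 x3.
wlog: a b / (a < b)%N => [sym ab|].
  case: (ltngtP a b) => [lt_ab|lt_ba|/val_inj //]; first exact: sym.
  by apply/esym/sym.
move=> lt_ab ab; case/eqP: x3; move: lt_ab ab.
case: a b => [[|[|[|//]]] ?] [[|[|[|//]]] ?] //= _;
  rewrite /cyclicMap /idMap /= ?x0 ?y0 => -[e1 e2].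
- by rewrite exprS {1}e1 e2; field.
- have xy1 : x * y = 1 by rewrite e1; field.
  have x_sqr : x = y ^+ 2 by rewrite expr2 {2}e2; field.
  by rewrite exprSr {2}x_sqr -exprMn xy1 expr1n.
- (* The equations multiply to x y = 1, because y / x and x / y are inverse. *)
  have -> : x ^+ 3 = x * (x / y) * (x * y) by field.
  have -> : x * y = x * y * ((y / x) * (x / y)) by field; rewrite x0 y0.
  by rewrite e1 -e2; field; rewrite x0 y0.
Qed.

Lemma cyclicMap_faithful (a b : 'I_3) :
  eq_rational (cyclicMap a) (cyclicMap b) -> a = b.
Proof.
move=> /eq_rational_agree[x [y [x0 y0 x3 [w [aw bw]]]]].
by apply: cyclicMap_agree x0 y0 x3 _; rewrite aw bw.
Qed.

End CyclicMaps.

Theorem theorem4p1 (R : realType) :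
  group_of_order_under_composition 3
    [set idMap; poincare1; poincare2 : planeMap R] /\
  eq_where_defined (pcomp idMap idMap) (idMap : planeMap R) /\
  (eq_where_defined (pcomp poincare1 idMap) (poincare1 : planeMap R) /\
   eq_where_defined (pcomp idMap poincare1) (poincare1 : planeMap R)) /\
  (eq_where_defined (pcomp poincare2 idMap) (poincare2 : planeMap R) /\
   eq_where_defined (pcomp idMap poincare2) (poincare2 : planeMap R)) /\
  (eq_where_defined (pcomp poincare1 poincare2) (idMap : planeMap R) /\
   eq_where_defined (pcomp poincare2 poincare1) (idMap : planeMap R)) /\
  eq_where_defined (pcomp poincare1 poincare1) (poincare2 : planeMap R) /\
  eq_where_defined (pcomp poincare2 poincare2) (poincare1 : planeMap R).
Proof.
split.
  exists 'I_3, (@cyclicMap R); split.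
  - exact: card_ord.
  - exact: range_cyclicMap.
  - exact: cyclicMap_faithful.
  - exact: eq_rational_pcomp_cyclicMap.
split; first exact: pcomp_idMapl.
split; first by split; [exact: pcomp_idMapr | exact: pcomp_idMapl].
split; first by split; [exact: pcomp_idMapr | exact: pcomp_idMapl].
split; first by split; [exact: poincare12 | exact: poincare21].
by split; [exact: poincare11 | exact: poincare22].
Qed.
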